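(* Let $G=(V,E)$ be a fixed (static) connected undirected graph on $n\ge 2$ vertices with vertex expansion $\alpha$. Then in the mobile telephone model on $G$ (topology never changes), the optimal rumor spreading algorithm terminates in $O((1/\alpha)\log n)$ rounds; that is, there is an absolute constant $C$ such that there exists a schedule of connections, valid in this model, that informs all nodes within $C\,(1/\alpha)\log n$ rounds, starting from any single source.
   Context: Vertex expansion: for $S\subseteq V$ let $\partial S=\{v\in V\setminus S: N(v)\cap S\neq\emptyset\}$ and $\alpha(S)=|\partial S|/|S|$; then $\alpha=\min_{S\subset V,\,0<|S|\le n/2}\alpha(S)$. Mobile telephone model: time proceeds in synchronous rounds; at the start of each round each node knows its neighbor set; each node may send a connection proposal to at most one neighbor; a node that sends a proposal cannot receive one; a node that sent no proposal and received at least one proposal may accept at most one of them; two nodes whose proposal was accepted are connected and can exchange an unbounded amount of information in that round. Hence the connections in a round form a matching of $G$. Rumor spreading problem: a single distinguished source starts with a rumor; the problem is solved once all nodes know the rumor (a node learns the rumor only via a connection with a node knowing it). *)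

(* Defs.v *)
From mathcomp Require Import all_boot all_order all_algebra.
From mathcomp Require Import reals exp.

Set Implicit Arguments.
Unset Strict Implicit.
Unset Printing Implicit Defensive.

Import Order.TTheory GRing.Theory Num.Theory.
Local Open Scope ring_scope.

Definition simple_graph (T : finType) (e : rel T) : Prop :=
  symmetric e /\ irreflexive e.

Definition connected_graph (T : finType) (e : rel T) : Prop :=
  forall u v : T, connect e u v.

Definition neighbors (T : finType) (e : rel T) (v : T) : {set T} :=
  [set u | e v u].

Definition boundary (T : finType) (e : rel T) (S : {set T}) : {set T} :=
  [set v in ~: S | neighbors e v :&: S != set0].

Definition set_expansion (R : realType) (T : finType) (e : rel T)
    (S : {set T}) : R :=
  #|boundary e S|%:R / #|S|%:R.

Definition expansion_set (T : finType) (S : {set T}) : bool :=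
  (0 < #|S|)%N && (2 * #|S| <= #|T|)%N.

(* The minimum of set_expansion over the nonempty sets of at most half the
   vertices. The initial value #|T| is only there because R has no greatest
   element: no set_expansion exceeds it, so it never affects the minimum when
   there are at least two vertices (see vertex_expansion_min below). *)
Definition vertex_expansion (R : realType) (T : finType) (e : rel T) : R :=
  \big[Num.min/#|T|%:R]_(S : {set T} | expansion_set S) set_expansion R e S.

Lemma set_expansion_le_card (R : realType) (T : finType) (e : rel T)
    (S : {set T}) : expansion_set S -> set_expansion R e S <= #|T|%:R.
Proof.
move=> /andP[S0 _]; rewrite /set_expansion ler_pdivrMr ?ltr0n // -natrM ler_nat.
by apply: leq_trans (max_card _) _; rewrite leq_pmulr.
Qed.

Lemma vertex_expansion_min (R : realType) (T : finType) (e : rel T) :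
  (1 < #|T|)%N ->
  (exists2 S : {set T}, expansion_set S &
     vertex_expansion R e = set_expansion R e S) /\
  (forall S : {set T}, expansion_set S ->
     vertex_expansion R e <= set_expansion R e S).
Proof.
move=> T1; split; last by move=> S hS; exact: bigmin_le_cond.
have /card_gt0P[x _] : (0 < #|T|)%N by exact: ltnW.
have hx : expansion_set [set x] by rewrite /expansion_set cards1.
have [S hS eqS] := @eq_bigmin _ _ _ _ [set x] (@expansion_set T) _ hx
  (fun S hS => set_expansion_le_card R e hS).
by exists S => //; rewrite -eqS.
Qed.

(* One round of the mobile telephone model: propose u is the recipient of the
   proposal sent by u (if any), accept v is the node whose proposal v accepts
   (if any). *)
Record round (T : finType) := Round {
  propose : T -> option T;
  accept : T -> option T
}.

Definition valid_round (T : finType) (e : rel T) (r : round T) : Prop :=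
  (forall u v : T, propose r u = Some v -> v \in neighbors e u) /\
  (forall u v : T, accept r v = Some u ->
     propose r u = Some v /\ propose r v = None).

Definition connection (T : finType) (r : round T) : rel T :=
  fun u v => (accept r u == Some v) || (accept r v == Some u).

(* Not used as a condition: the rules of a round already force this. *)
Lemma connection_matching (T : finType) (e : rel T) (r : round T) :
  valid_round e r ->
  forall u v w : T, connection r u v -> connection r u w -> v = w.
Proof.
move=> [_ hacc] u v w /orP[]/eqP h1 /orP[]/eqP h2.
- by move: h1; rewrite h2 => -[].
- by have [_ +] := hacc _ _ h1; have [-> _] := hacc _ _ h2.
- by have [+ _] := hacc _ _ h1; have [_ ->] := hacc _ _ h2.
- by have [+ _] := hacc _ _ h1; have [-> _] := hacc _ _ h2 => -[].
Qed.

Definition schedule (T : finType) := nat -> round T.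

Definition valid_schedule (T : finType) (e : rel T) (sched : schedule T) :
    Prop :=
  forall t : nat, valid_round e (sched t).

(* The nodes knowing the rumor after t rounds, the source being s; a node
   informed during a round passes the rumor on only from the next round. *)
Fixpoint informed (T : finType) (sched : schedule T) (s : T) (t : nat) :
    {set T} :=
  if t is t'.+1 then
    let I := informed sched s t' in
    I :|: [set v | [exists u in I, connection (sched t') u v]]
  else [set s].

(* Main.v *)
(* The endpoints of a maximal matching across the cut (A, V \ A) cover every
   edge of the cut, so deleting them from the smaller side X of the cut leaves
   a set whose boundary consists of matched vertices only. Hence the matching
   has at least alpha |X| / 6 edges, and a round connecting its edges multiplies
   the ratio |V \ A| / |A| of uninformed to informed nodes by at most
   1 - alpha / 12. This ratio starts below n and is 0 once it is below 1/n, so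
   O((1 / alpha) log n) rounds suffice. *)
Require Import Defs.
From mathcomp Require Import all_boot all_order all_algebra.
From mathcomp Require Import reals exp.
From mathcomp Require Import sequences.
From mathcomp Require Import ring lra.

Set Implicit Arguments.
Unset Strict Implicit.
Unset Printing Implicit Defensive.

Import Order.TTheory GRing.Theory Num.Theory.
Local Open Scope ring_scope.

(** * Maximum matchings across a cut, and the rounds they induce *)

Section CutMatching.
Variables (T : finType) (e : rel T).
Implicit Types (A S X C : {set T}) (M : {set T * T}).

(** Edges are stored as pairs with the endpoint in [A] first. First and second components lie on
    opposite sides of the cut, so comparing like components is enough for disjointness. *)
Definition cut_matching A M : bool :=
  [forall p in M, [&& p.1 \in A, p.2 \notin A & e p.1 p.2]] &&
  [forall p in M, forall q in M, (p.1 == q.1) || (p.2 == q.2) ==> (p == q)].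

Definition max_matching A : {set T * T} :=
  [arg max_(M > set0 | cut_matching A M) #|M|].

Lemma max_matchingP A :
  cut_matching A (max_matching A) /\
  forall M, cut_matching A M -> (#|M| <= #|max_matching A|)%N.
Proof.
rewrite /max_matching; case: arg_maxnP => [|M hM max_M]; last by split.
by apply/andP; split; apply/forallP => p; rewrite inE.
Qed.

Lemma max_matching_edge A p : p \in max_matching A ->
  [/\ p.1 \in A, p.2 \notin A & e p.1 p.2].
Proof.
have [/andP[/forallP h _] _] := max_matchingP A.
by move=> pM; have /and3P := implyP (h p) pM.
Qed.

Lemma max_matching_inj A p q :
  p \in max_matching A -> q \in max_matching A ->
  (p.1 == q.1) || (p.2 == q.2) -> p = q.
Proof.
have [/andP[_ /forallP h] _] := max_matchingP A.
move=> pM qM pq; apply/eqP.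
by have /forallP/(_ q)/implyP/(_ qM)/implyP/(_ pq) := implyP (h p) pM.
Qed.

Definition matched A : {set T} :=
  [set p.1 | p in max_matching A] :|: [set p.2 | p in max_matching A].

Lemma card_matched A : (#|matched A| <= 2 * #|max_matching A|)%N.
Proof.
rewrite mul2n -addnn; apply: leq_trans (leq_card_setU _ _) _.
by apply: leq_add; exact: leq_imset_card.
Qed.

(** Otherwise [(x, y)] could be added to the matching, against its maximality. *)
Lemma matched_cover A x y : x \in A -> y \notin A -> e x y ->
  (x \in matched A) || (y \in matched A).
Proof.
move=> xA yA exy; apply/norP; rewrite !inE => -[/norP[x1 _] /norP[_ y2]].
have h1 p : p \in max_matching A -> x != p.1.
  by move=> pM; apply: contraNneq x1 => ->; exact: imset_f.
have h2 p : p \in max_matching A -> y != p.2.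
  by move=> pM; apply: contraNneq y2 => ->; exact: imset_f.
have xyM : (x, y) \notin max_matching A.
  by apply/negP => /h1; rewrite eqxx.
have [_ /(_ ((x, y) |: max_matching A))] := max_matchingP A.
rewrite cardsU1 xyM add1n ltnn => no_ext; apply: notF; apply: no_ext.
apply/andP; split.
  apply/forallP => p; apply/implyP; rewrite in_setU1 => /orP[/eqP->/=|pM].
    by rewrite xA yA.
  by have [-> -> ->] := max_matching_edge pM.
apply/forallP => p; apply/implyP => hp; apply/forallP => q; apply/implyP => hq.
apply/implyP; move: hp hq; rewrite !in_setU1.
case/orP=> [/eqP->|pM] /orP[/eqP->|qM] //=.
- by rewrite (negPf (h1 q qM)) (negPf (h2 q qM)).
- by rewrite ![_ == x]eq_sym ![_ == y]eq_sym (negPf (h1 p pM)) (negPf (h2 p pM)).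
- by move=> pq; rewrite (max_matching_inj pM qM pq).
Qed.

(** A boundary vertex outside [X] has an edge to some vertex of [X] not in [C]; this edge leaves
    [X], so [C] must cover it at its outer end. *)
Lemma boundary_setD_cover X C :
  (forall x y, x \in X -> y \notin X -> e y x -> (x \in C) || (y \in C)) ->
  boundary e (X :\: C) \subset C.
Proof.
move=> cov; apply/subsetP => y; rewrite !inE negb_and negbK.
case/andP=> /orP[//|yX] /set0Pn[x]; rewrite !inE => /andP[eyx /andP[xC xX]].
by have := cov x y xX yX eyx; rewrite (negPf xC).
Qed.

Definition next_informed A : {set T} :=
  A :|: [set p.2 | p in max_matching A].

Lemma card_next_informed A :
  #|next_informed A| = (#|A| + #|max_matching A|)%N.
Proof.
rewrite cardsU (_ : A :&: _ = set0) ?cards0 ?subn0; last first.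
  apply/setP => y; rewrite !inE; apply/negbTE/negP => /andP[yA /imsetP[p pM py]].
  by have [_ + _] := max_matching_edge pM; rewrite -py yA.
rewrite card_in_imset // => p q pM qM /eqP pq.
by apply: max_matching_inj pM qM _; rewrite pq orbT.
Qed.

(** Informed endpoints propose and uninformed ones accept; both choices are forced, since a matched
    vertex has only one partner. *)
Definition matching_round A : round T :=
  Round (fun u => [pick v | (u, v) \in max_matching A])
        (fun v => [pick u | (u, v) \in max_matching A]).

Lemma accept_matching_round A u v :
  (accept (matching_round A) v == Some u) = ((u, v) \in max_matching A).
Proof.
rewrite /=; case: pickP => [w wM|/(_ u)->//].
apply/eqP/idP => [[<-//]|uM].
by have := max_matching_inj wM uM; rewrite eqxx orbT => /(_ isT)[->].
Qed.

Lemma valid_matching_round A : valid_round e (matching_round A).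
Proof.
split=> [u v /=|u v /eqP].
  by case: pickP => // w /max_matching_edge[_ _ /= euw] [<-]; rewrite inE.
rewrite accept_matching_round => uvM; split => /=.
  case: pickP => [w wM|/(_ v)]; last by rewrite uvM.
  by have := max_matching_inj wM uvM; rewrite eqxx => /(_ isT)[->].
case: pickP => // w /max_matching_edge[/= vA _ _].
by have [_ /= + _] := max_matching_edge uvM; rewrite vA.
Qed.

Lemma informed_matching_round A :
  A :|: [set v | [exists u in A, connection (matching_round A) u v]] =
  next_informed A.
Proof.
apply/setP => v; rewrite !in_setU inE; congr (_ || _).
apply/exists_inP/imsetP => [[u uA]|[[u w] uwM ->]].
  rewrite /connection !accept_matching_round.
  case/orP=> [/max_matching_edge[_ /= + _]|uvM]; first by rewrite uA.
  by exists (u, v).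
have [/= uA _ _] := max_matching_edge uwM.
by exists u => //=; rewrite /connection !accept_matching_round uwM orbT.
Qed.

(** Iterating [next_informed] avoids a circularity: [informed] itself takes the schedule as an
    argument. *)
Definition matching_schedule (s : T) : schedule T :=
  fun t => matching_round (iter t next_informed [set s]).

Lemma informed_matching_schedule s t :
  informed (matching_schedule s) s t = iter t next_informed [set s].
Proof. by elim: t => //= t ->; exact: informed_matching_round. Qed.

End CutMatching.

(** * Two auxiliary facts on cardinals and real inequalities *)

Lemma exists_set_card (T : finType) (k : nat) : (k <= #|T|)%N ->
  exists S : {set T}, #|S| = k.
Proof.
move=> kT; exists [set x in take k (enum T)].
rewrite cardsE (card_uniqP _) ?take_uniq ?enum_uniq //.
by rewrite size_takel // -cardE.
Qed.

(** Here [a] counts the informed nodes before a round, [u] the uninformed ones after it, and [m] the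
    newly informed. The first alternative bounds [a / (a + m)] by the factor, the second bounds
    [u / (u + m)]. *)
Lemma ratio_contraction (R : realFieldType) (c a u m : R) :
  0 < c -> c <= 2 -> 0 <= a -> 0 <= u -> 0 <= m ->
  c / 6 * a <= m \/ c / 6 * (u + m) <= m ->
  u * a <= (1 - c / 12) * ((u + m) * (a + m)).
Proof.
move=> c_gt0 c_le2 a0 u0 m0 m_ge.
have q0 : 0 <= 1 - c / 12 by lra.
have um0 := addr_ge0 u0 m0; have am0 := addr_ge0 a0 m0.
case: m_ge => m_ge.
  by rewrite mulrCA; apply: ler_pM; rewrite ?lerDl //; nra.
by rewrite mulrA; apply: ler_pM; rewrite ?lerDl //; nra.
Qed.

(** * Bounds from vertex expansion and decay of the uninformed ratio *)

Section Expansion.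
Variables (R : realType) (T : finType) (e : rel T).
Hypothesis T_gt1 : (1 < #|T|)%N.
Local Notation alpha := (vertex_expansion R e).

(** A set of floor(n/2) vertices has at most ceil(n/2) boundary vertices, which is at most twice its
    size. *)
Lemma vertex_expansion_le2 : alpha <= 2.
Proof.
have half_le : (#|T|./2 <= #|T|)%N by rewrite -divn2 leq_div.
have half_gt0 : (0 < #|T|./2)%N by rewrite half_gt0.
have [S cardS] := exists_set_card half_le.
have [_ /(_ S)] := vertex_expansion_min R e T_gt1.
rewrite /expansion_set cardS half_gt0 /= mul2n.
have odd_half := odd_double_half #|T|.
rewrite -{2}odd_half leq_addl => /(_ isT) /le_trans; apply.
rewrite /set_expansion cardS ler_pdivrMr ?ltr0n // -natrM ler_nat.
apply: (@leq_trans #|~: S|).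
  by apply/subset_leq_card/subsetP => x; rewrite inE => /andP[].
rewrite cardsCs setCK cardS leq_subLR mul2n.
have := leq_b1 (odd #|T|); rewrite -(leq_add2r #|T|./2.*2) odd_half.
by move=> /leq_trans; apply; rewrite leq_add2r.
Qed.

(** A minimizing set with empty boundary would be closed under adjacency, hence by connectivity the
    whole vertex set, which is more than half of it. *)
Lemma vertex_expansion_gt0 :
  simple_graph e -> connected_graph e -> 0 < alpha.
Proof.
move=> [e_sym _] e_conn; have [[S hS ->] _] := vertex_expansion_min R e T_gt1.
have /andP[S_gt0 S_half] := hS.
rewrite /set_expansion divr_gt0 ?ltr0n // card_gt0; apply/eqP => bS0.
have S_closed : closed e (mem S).
  apply: (intro_closed (sym_connect_sym e_sym)) => x y exy xS.
  apply: contraT => yS; have : y \in boundary e S.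
    by rewrite !inE yS; apply/set0Pn; exists x; rewrite !inE e_sym exy.
  by rewrite bS0 inE.
have /card_gt0P[x xS] := S_gt0.
have ST : S = [set: T].
  by apply/setP => y; rewrite inE -(closed_connect S_closed (e_conn x y)).
move: S_half; rewrite ST cardsT mul2n -addnn -{3}[#|T|]addn0 leq_add2l leqn0.
by rewrite -leqn0 leqNgt (ltnW T_gt1).
Qed.

(** The product form also covers the empty set, which may arise as [X :\: C] below. *)
Lemma vertex_expansion_le_boundary (X : {set T}) :
  (2 * #|X| <= #|T|)%N -> alpha * #|X|%:R <= #|boundary e X|%:R.
Proof.
move=> X_half; have [X0|X_gt0] := posnP #|X|.
  by rewrite X0 mulr0 ler0n.
rewrite -ler_pdivlMr ?ltr0n //.
have [_ h] := vertex_expansion_min R e T_gt1; apply: h.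
by rewrite /expansion_set X_gt0.
Qed.

Hypotheses (e_simple : simple_graph e) (e_conn : connected_graph e).

Lemma cover_card_ge (X C : {set T}) (m : nat) :
  (2 * #|X| <= #|T|)%N -> (#|C| <= 2 * m)%N ->
  (forall x y, x \in X -> y \notin X -> e y x -> (x \in C) || (y \in C)) ->
  alpha / 6 * #|X|%:R <= m%:R.
Proof.
move=> X_half C_m cov.
have a_gt0 := vertex_expansion_gt0 e_simple e_conn.
have a_le2 := vertex_expansion_le2.
have D_half : (2 * #|X :\: C| <= #|T|)%N.
  by apply: leq_trans X_half; rewrite leq_mul2l subset_leq_card // subsetDl.
have D_le : alpha * #|X :\: C|%:R <= 2 * m%:R.
  apply: le_trans (vertex_expansion_le_boundary D_half) _.
  rewrite -natrM ler_nat; apply: leq_trans C_m.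
  exact/subset_leq_card/boundary_setD_cover.
have X_le : #|X|%:R <= #|X :\: C|%:R + 2 * m%:R :> R.
  rewrite -natrM -natrD ler_nat -(cardsID C X) addnC leq_add2l.
  by apply: leq_trans C_m; rewrite subset_leq_card // subsetIr.
have m_ge0 : 0 <= m%:R :> R by exact: ler0n.
(* The 6 arises from [alpha * #|X| <= 2 * m + alpha * (2 * m)] and [alpha <= 2]. *)
nra.
Qed.

Lemma max_matching_ge (A : {set T}) :
  ((2 * #|A| <= #|T|)%N -> alpha / 6 * #|A|%:R <= #|max_matching e A|%:R) /\
  ((2 * #|~: A| <= #|T|)%N ->
    alpha / 6 * #|~: A|%:R <= #|max_matching e A|%:R).
Proof.
have [e_sym _] := e_simple.
split=> half; apply: (cover_card_ge half (card_matched e A)) => x y.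
  by rewrite e_sym; exact: matched_cover.
by rewrite !in_setC negbK => xA yA eyx; rewrite orbC; exact: matched_cover.
Qed.

(** The contraction of the ratio of uninformed to informed nodes, with denominators cleared. *)
Lemma uninformed_ratio_step (A : {set T}) :
  #|~: next_informed e A|%:R * #|A|%:R <=
  (1 - alpha / 12) * (#|~: A|%:R * #|next_informed e A|%:R) :> R.
Proof.
have a_gt0 := vertex_expansion_gt0 e_simple e_conn.
have a_le2 := vertex_expansion_le2.
have [small_A small_CA] := max_matching_ge A.
have cardA := cardsC A; have cardN := cardsC (next_informed e A).
have cardNE := card_next_informed e A.
have uE : #|~: A|%:R = #|~: next_informed e A|%:R + #|max_matching e A|%:R :> R.
  rewrite -natrD; congr _%:R; apply/eqP.
  rewrite -(eqn_add2l #|A|) cardA -cardN cardNE -!addnA eqn_add2l.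
  by rewrite addnC.
rewrite cardNE natrD uE; apply: ratio_contraction; rewrite ?ler0n //.
(* Whichever side of the cut has at most half the vertices supplies the bound on the matching. *)
have [/small_A m_ge|A_half] := leqP (2 * #|A|) #|T|; first by left.
right; rewrite -uE; apply: small_CA.
rewrite -(leq_add2l (2 * #|A|)) -mulnDr cardA mul2n -addnn leq_add2r.
exact: ltnW.
Qed.

Lemma uninformed_ratio (s : T) (t : nat) :
  #|~: iter t (next_informed e) [set s]|%:R <=
  (1 - alpha / 12) ^+ t * #|T|%:R * #|iter t (next_informed e) [set s]|%:R :> R.
Proof.
have a_le2 := vertex_expansion_le2.
elim: t => [|t IH] /=.
  by rewrite cards1 expr0 mul1r mulr1 ler_nat max_card.
move: IH; set A := iter t _ _ => IH; have step := uninformed_ratio_step A.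
(* The source stays informed, so [#|A|] can be cancelled. *)
have A_gt0 : 0 < #|A|%:R :> R.
  rewrite ltr0n card_gt0; apply/set0Pn; exists s.
  by rewrite /A; elim: t {IH step A} => [|t IH] /=; rewrite inE ?IH.
have q0 : 0 <= 1 - alpha / 12 by lra.
rewrite -(ler_pM2r A_gt0); apply: le_trans step _.
have /(ler_wpM2l q0) := ler_wpM2r (ler0n R #|next_informed e A|) IH.
by move=> /le_trans; apply; rewrite exprS le_eqVlt; apply/orP; left; apply/eqP; ring.
Qed.

Lemma all_informed (s : T) (t : nat) :
  24 * (1 / alpha) * ln #|T|%:R < t%:R ->
  iter t (next_informed e) [set s] = [set: T].
Proof.
move=> t_gt; have a_gt0 := vertex_expansion_gt0 e_simple e_conn.
have a_le2 := vertex_expansion_le2.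
have n_gt0 : 0 < #|T|%:R :> R by rewrite ltr0n ltnW.
(* The number of uninformed nodes is a natural number, so a bound below 1 makes it 0. *)
apply: setC_inj; apply/eqP; rewrite setCT -cards_eq0 -leqn0 -ltnS -(ltr_nat R).
apply: le_lt_trans (uninformed_ratio s t) _.
have q0 : 0 <= 1 - alpha / 12 by lra.
have qt : (1 - alpha / 12) ^+ t <= expR (- (alpha / 12) * t%:R).
  rewrite expRM_natr; apply: lerXn2r; rewrite ?nnegrE ?expR_ge0 //.
  exact: expR_ge1Dx.
set A := iter t _ _.
have A_le : #|A|%:R <= #|T|%:R :> R by rewrite ler_nat max_card.
(* Both factors n become [expR (ln n)], so the bound is below 1 once [alpha / 12 * t] exceeds
   [2 * ln n]; hence the 24. *)
apply: (@le_lt_trans _ _ (expR (- (alpha / 12) * t%:R) * #|T|%:R * #|T|%:R)).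
  by rewrite !ler_pM ?mulr_ge0 ?exprn_ge0 // ltW.
rewrite -{1 2}(lnK n_gt0) -!expRD expR_lt1.
move: t_gt; rewrite mul1r mulrAC ltr_pdivrMr //.
set l := ln _; lra.
Qed.

(** This absorbs the extra round due to rounding up; it follows from [alpha <= 2] and
    [ln n >= 1/2]. *)
Lemma ln_card_ge : 1 <= 4 * (1 / alpha) * ln #|T|%:R.
Proof.
have a_gt0 := vertex_expansion_gt0 e_simple e_conn.
have a_le2 := vertex_expansion_le2.
have n2 : 2 <= #|T|%:R :> R by rewrite ler_nat.
have n_gt0 : 0 < #|T|%:R :> R by lra.
have ln_ge : 2^-1 <= ln #|T|%:R :> R.
  (* With x = ln n, [expR (- x) >= 1 - x] reads 1/n >= 1 - ln n, while 1/n <= 1/2. *)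
  have := expR_ge1Dx (- ln #|T|%:R : R).
  rewrite expRN lnK ?posrE //.
  have : #|T|%:R^-1 <= 2^-1 :> R by rewrite lef_pV2 ?posrE.
  lra.
rewrite mul1r mulrAC ler_pdivlMr //; lra.
Qed.

End Expansion.

Theorem theorem1 (R : realType) :
  exists C : R, 0 < C /\
    forall (T : finType) (e : rel T),
      simple_graph e -> connected_graph e -> (1 < #|T|)%N ->
      forall s : T,
        exists (sched : schedule T) (t : nat),
          [/\ valid_schedule e sched,
              t%:R <= C * (1 / vertex_expansion R e) * ln (#|T|%:R)
            & informed sched s t = [set: T]].
Proof.
(* 28 = 24 + 4: the least integer above [x] is at most [x + 1], and [ln_card_ge] pays for the 1. *)
exists 28; split=> // T e e_simple e_conn T_gt1 s.
have h1 := ln_card_ge R T_gt1 e_simple e_conn.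
set x := 24 * (1 / vertex_expansion R e) * ln #|T|%:R.
have x0 : 0 <= x by rewrite /x; lra.
have /andP[t_le t_gt] := truncn_itv x0.
exists (matching_schedule e s), (Num.truncn x).+1; split.
- by move=> t; exact: valid_matching_round.
- by rewrite -natr1; move: t_le; rewrite /x; lra.
- by rewrite informed_matching_schedule; exact: all_informed t_gt.
Qed.
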